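(* Let $K$ be a field of characteristic $0$ with algebraic closure $\overline{K}$, let $n\ge 2$, and let $g\in K[z]$ be a polynomial of degree $d$ with $n$ critical points. There exist $k_0,\ldots,k_{n-2}\in\mathbb{N}$ with $n-1\le\sum_{l=0}^{n-2}k_l\le d-2$ and $a,c,\gamma_0,\ldots,\gamma_{n-2}\in\overline{K}$ such that $g$ is conjugate to $$ a\left(\frac{d!}{\left(d-\sum_{l=0}^{n-2}k_l-1\right)!}\ \sum_{j_0=0}^{k_0}\sum_{j_1=0}^{k_1}\cdots\sum_{j_{n-2}=0}^{k_{n-2}}\left(\prod_{i=0}^{n-2}(-\gamma_i)^{k_i-j_i}\binom{k_i}{j_i}\right)\frac{z^{\,d+\sum_{l=0}^{n-2}(j_l-k_l)}}{d+\sum_{l=0}^{n-2}(j_l-k_l)}\right)+c . $$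
   Context: ''$n$ critical points'' means exactly $n$ distinct affine critical points in $\overline{K}$ (not counting $\infty$). Conjugation is over $\overline{K}$: $g$ is conjugate to $f$ if $f=\phi^{-1}\circ g\circ\phi$ for some $\phi\in\mathrm{PGL}_2(\overline{K})$. *)

(* Defs.v *)
From HB Require Import structures.
From mathcomp Require Import all_boot all_order all_algebra.
Set Implicit Arguments.
Unset Strict Implicit.
Unset Printing Implicit Defensive.
Import GRing.Theory.
Local Open Scope ring_scope.

(* L is algebraically closed by its type, so "L is an algebraic closure of K
   via iota" reduces to every element of L being algebraic over K. *)
Definition is_algebraic_closure (K : fieldType) (L : closedFieldType)
  (iota : {rmorphism K -> L}) : Prop :=
  forall x : L, algebraicOver iota x.

(* Affine critical points, without multiplicity; a constant polynomial over
   an infinite field satisfies this for no n. *)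
Definition has_n_critical_points (L : fieldType) (n : nat) (p : {poly L}) :
  Prop :=
  exists s : seq L,
    [/\ uniq s, size s = n & forall z : L, (z \in s) = root p^`() z].

(* P^1(L) = L + {oo}, with None as the point oo. *)
Definition P1 (L : fieldType) : Type := option L.

(* The self-map of P^1(L) induced by a polynomial: a nonconstant polynomial
   fixes oo, a constant one takes its value there as well. *)
Definition poly_P1 (L : fieldType) (p : {poly L}) (P : P1 L) : P1 L :=
  match P with
  | Some z => Some p.[z]
  | None => if (size p <= 1)%N then Some p`_0 else None
  end.

(* The action z |-> (A00 z + A01) / (A10 z + A11) of an invertible matrix. *)
Definition mobius (L : fieldType) (A : 'M[L]_2) (P : P1 L) : P1 L :=
  match P with
  | Some z =>
      if A 1 0 * z + A 1 1 == 0 then None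
      else Some ((A 0 0 * z + A 0 1) / (A 1 0 * z + A 1 1))
  | None => if A 1 0 == 0 then None else Some (A 0 0 / A 1 0)
  end.

(* g is conjugate to f: f = phi^-1 o g o phi for some phi in PGL_2(L). The
   class phi is given by a representative A in GL_2(L). Over an infinite field,
   equality of these self-maps of P^1(L) is equality of rational maps. *)
Definition conjugate_to (L : fieldType) (g f : {poly L}) : Prop :=
  exists2 A : 'M[L]_2, A \in unitmx &
    forall P : P1 L,
      poly_P1 f P = mobius (invmx A) (poly_P1 g (mobius A P)).

(* The iterated sum over 0 <= j_i <= k_i is a sum over dependent finite
   functions j. The exponent d + \sum_l (j_l - k_l) is written so that natural
   number subtraction does not truncate when \sum_l k_l <= d. *)
Definition normal_form (L : fieldType) (d m : nat) (k : 'I_m -> nat)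
  (gamma : 'I_m -> L) : {poly L} :=
  (d`!%:R / (d - \sum_(l < m) k l - 1)`!%:R) *:
    \sum_(j : {dffun forall i : 'I_m, 'I_(k i).+1})
      let e := (d + \sum_(l < m) j l - \sum_(l < m) k l)%N in
      (\prod_(i < m) ((- gamma i) ^+ (k i - j i) * 'C(k i, j i)%:R)) *:
        (e%:R^-1 *: 'X^e).

(* Main.v *)
Require Import Defs.
From HB Require Import structures.
From mathcomp Require Import all_boot all_order all_algebra.
Import GRing.Theory.
Local Open Scope ring_scope.

(** A conjugacy by a translation [z |-> z + s] keeps the shape of the derivative
    and moves its roots by [-s].  Taking for [s] a critical point of [g], the
    conjugate [f] has derivative
    [b *: ('X^m * \prod_i ('X - gamma_i)^+ (k_i))], where the [gamma_i] are the
    other [n - 1] critical points translated by [-s], the [k_i > 0] are their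
    multiplicities and [m >= 1] is the multiplicity of [0]; counting degrees,
    [m + \sum_i k_i = d - 1], which gives both bounds on [\sum_i k_i]
    ([poly_factor_root_seq]).

    The binomial expansion of the factors [('X - gamma_i)^+ (k_i)], integrated
    term by term, is precisely the multiple sum of the normal form: its
    derivative is that same product up to the constant [d! / m!]
    ([deriv_normal_form]).  In characteristic 0 this constant is invertible and
    a polynomial is determined by its derivative up to a constant
    ([deriv_eq_addC]), which provides [a] and [c]. *)

Lemma deriv_eq_addC (L : fieldType) (charL0 : [pchar L] =i pred0)
  (p q : {poly L}) :
  p^`() = q^`() -> p = q + (p`_0 - q`_0)%:P.
Proof.
move=> eq_pq; apply/polyP=> -[|i]; rewrite coefD coefC /=;
  rewrite ?addr0 1?addrC ?subrK //.
have := congr1 (fun r : {poly L} => r`_i) eq_pq.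
rewrite !coef_deriv -[LHS]mulr_natr -[RHS]mulr_natr => /mulIf-> //.
by move/pcharf0P: charL0 => ->.
Qed.

Lemma size_deriv_char0 {L : fieldType} (charL0 : [pchar L] =i pred0)
  (p : {poly L}) :
  size p^`() = (size p).-1.
Proof.
have [-> | p0] := eqVneq p 0; first by rewrite deriv0 size_poly0.
case: (posnP (size p).-1) => [size_p | size_p].
  by apply/eqP; rewrite size_p -leqn0 -size_p size_poly.
apply: size_poly_eq; rewrite prednK //.
rewrite -mulr_natr mulf_eq0 negb_or -/(lead_coef p) lead_coef_eq0 p0 /=.
by move/pcharf0P: charL0 => ->; rewrite -lt0n.
Qed.

(** Provides the multiplicities [k_l], as positive exponents attached to the
    given enumeration of the critical points. *)
Lemma poly_factor_root_seq {L : closedFieldType} {p : {poly L}} {s : seq L} :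
  p != 0 -> uniq s -> (forall z, (z \in s) = root p z) ->
  exists mu : L -> nat,
    [/\ forall z, z \in s -> (0 < mu z)%N,
        (\sum_(z <- s) mu z)%N = (size p).-1
      & p = lead_coef p *: \prod_(z <- s) ('X - z%:P) ^+ mu z].
Proof.
move=> p0 s_uniq root_s; have [r p_r] := closed_field_poly_normal p.
have lp0 : lead_coef p != 0 by rewrite lead_coef_eq0.
have r_s z : (z \in r) = (z \in s).
  by rewrite root_s p_r rootZ // root_prod_XsubC.
have perm_rs : perm_eq (undup r) s.
  by apply: uniq_perm; rewrite ?undup_uniq // => z; rewrite mem_undup.
exists (fun z => count_mem z r); split.
- by move=> z; rewrite -r_s -has_pred1 has_count.
- rewrite p_r size_scale // size_prod_XsubC /= -(perm_big _ perm_rs) /=.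
  by rewrite -sum1_size -[RHS]big_undup_iterop_count; apply: eq_bigr => z _;
     rewrite Monoid.iteropE iter_addn_0 mul1n.
- by rewrite -(perm_big _ perm_rs) prodr_undup_exp_count.
Qed.

(** The index family of each sum depends on the factor, hence the dependent
    functions on the right; they are handled as the choice functions into the
    disjoint union of the index types that respect the tags. *)
Lemma prodr_sum_dffun (R : comNzRingType) (I : finType) (T_ : I -> finType)
  (F : forall i, T_ i -> R) :
  \prod_i \sum_(j : T_ i) F i j =
  \sum_(f : {dffun forall i, T_ i}) \prod_i F i (f i).
Proof.
under eq_bigr => i _ do rewrite (big_tag F).
rewrite bigA_distr_big_dep.
pose P i := [ffun x => F i x].
transitivity (\sum_(t : fprod T_) \prod_(i in I) P i (t i)).
  rewrite big_fprod; apply: eq_bigr => f _; apply: eq_bigr => i _.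
  by rewrite /untag; case: eqP => // e; rewrite ffunE.
rewrite (reindex (@fprod_of_dffun I T_)); last first.
  exact/onW_bij/fprod_of_dffun_bij.
apply: eq_bigr => f _; apply: eq_bigr => i _.
by rewrite ffunE fprodE.
Qed.

Lemma exprXsubC (R : comNzRingType) (x : R) (k : nat) :
  ('X - x%:P) ^+ k =
  \sum_(j < k.+1) ((- x) ^+ (k - j) * 'C(k, j)%:R) *: 'X^j.
Proof.
rewrite addrC -polyCN exprDn; apply: eq_bigr => j _.
by rewrite -polyC_exp mul_polyC scalerMnl mulr_natr.
Qed.

Lemma deriv_normal_form {L : fieldType} (charL0 : [pchar L] =i pred0)
  (d m : nat) (k : 'I_m -> nat) (gamma : 'I_m -> L) :
  (\sum_l k l < d)%N ->
  (normal_form d k gamma)^`() =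
  (d`!%:R / (d - \sum_l k l - 1)`!%:R) *:
    ('X^(d - \sum_l k l - 1) * \prod_l ('X - (gamma l)%:P) ^+ k l).
Proof.
move=> lt_kd; rewrite /normal_form derivZ; congr (_ *: _).
under [X in _ = _ * X]eq_bigr => l _ do rewrite exprXsubC.
rewrite prodr_sum_dffun big_distrr /= raddf_sum /=; apply: eq_bigr => j _.
rewrite scaler_prod prodrXr -scalerAr -exprD !derivZ derivXn.
set e := (_ + _ - _)%N.
have e_gt0 : (0 < e)%N by rewrite /e subn_gt0 ltn_addr.
(* Differentiating ['X^e / e] cancels [e], nonzero in characteristic 0. *)
rewrite -scaler_nat [(_^-1) *: _]scalerA mulVf ?scale1r; last first.
  by move/pcharf0P: charL0 => ->; rewrite -lt0n.
congr (_ *: 'X^_).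
by rewrite /e -subn1 [RHS]addnBAC ?subn_gt0 // addnBAC // ltnW.
Qed.

Definition translation_mx {L : fieldType} (s : L) : 'M[L]_2 :=
  1%:M + s *: delta_mx 0 1.

Lemma translation_mxM {L : fieldType} (s t : L) :
  translation_mx s *m translation_mx t = translation_mx (s + t).
Proof.
rewrite /translation_mx mulmxDl mul1mx mulmxDr mulmx1 -scalemxAl -scalemxAr.
by rewrite mul_delta_mx_0 // !scaler0 addr0 scalerDl addrAC addrA.
Qed.

Lemma translation_mxN {L : fieldType} (s : L) :
  translation_mx s *m translation_mx (- s) = 1%:M.
Proof. by rewrite translation_mxM subrr /translation_mx scale0r addr0. Qed.

Lemma mobius_translation {L : fieldType} (s : L) (P : P1 L) :
  mobius (translation_mx s) P = omap (+%R^~ s) P.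
Proof.
case: P => [z|]; rewrite /= !mxE /= ?mulr0 ?mulr1 ?addr0 ?add0r ?mul0r ?mul1r.
  by rewrite ?add0r oner_eq0 divr1.
by rewrite eqxx.
Qed.

Lemma conjugate_to_translation (L : fieldType) (g : {poly L}) (s : L) :
  (1 < size g)%N -> conjugate_to g (g \Po ('X + s%:P) - s%:P).
Proof.
move=> g_gt1.
have [A_unit _] := mulmx1_unit (translation_mxN s).
exists (translation_mx s) => // P.
have -> : invmx (translation_mx s) = translation_mx (- s).
  by rewrite -[LHS]mulmx1 -(translation_mxN s) mulKmx.
rewrite !mobius_translation; case: P => [z|] /=.
  by rewrite !hornerE horner_comp !hornerE.
have size_comp : size (g \Po ('X + s%:P)) = size g.
  by rewrite size_comp_poly2 // size_XaddC.
have size_f : size (g \Po ('X + s%:P) - s%:P) = size g.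
  rewrite size_polyDl // size_polyN size_comp.
  exact: leq_ltn_trans (size_polyC_leq1 _) g_gt1.
by rewrite size_f leqNgt g_gt1.
Qed.

Theorem theorem21 (K : fieldType) (charK0 : [pchar K] =i pred0)
  (Kbar : closedFieldType) (iota : {rmorphism K -> Kbar})
  (closK : is_algebraic_closure iota)
  (n : nat) (hn : (2 <= n)%N) (d : nat) (g : {poly K})
  (deg_g : size g = d.+1)
  (crit_g : has_n_critical_points n (map_poly iota g)) :
  exists k : 'I_(n - 1) -> nat,
    [/\ forall l, (0 < k l)%N,
        (n - 1 <= \sum_(l < n - 1) k l)%N,
        (\sum_(l < n - 1) k l <= d - 2)%N
      & exists (a c : Kbar) (gamma : 'I_(n - 1) -> Kbar),
          conjugate_to (map_poly iota g)
            (a *: normal_form d k gamma + c%:P)].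
Proof.
have charL0 : [pchar Kbar] =i pred0 by move=> p; rewrite (fmorph_pchar iota).
have natr_eq0 : forall m, (m%:R == 0 :> Kbar) = (m == 0)%N by apply/pcharf0P.
have {deg_g} : size (map_poly iota g) = d.+1 by rewrite size_map_poly.
case: crit_g; move: (map_poly iota g) => {}g s [s_uniq size_s crit_s] deg_g.
(* A zero derivative would make every point critical; but 1 plus the product
   of the [X - z] over the critical points [z] has a root, which is not one of
   them. *)
have g'0 : g^`() != 0.
  apply: contraT => /negbNE/eqP g'0.
  pose q := \prod_(z <- s) ('X - z%:P) : {poly Kbar}.
  have size_q : size (q + 1) = n.+1.
    by rewrite size_polyDl size_prod_XsubC size_s // size_poly1 ltnS ltnW.
  have /closed_rootP[z] : size (q + 1) != 1%N.
    by rewrite size_q eqSS -lt0n ltnW.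
  have : root q z by rewrite root_prod_XsubC crit_s g'0 root0.
  by rewrite !rootE hornerD hornerC => /eqP->; rewrite add0r oner_eq0.
have size_g' : size g^`() = d by rewrite size_deriv_char0 // deg_g.
have [mu [mu_gt0 sum_mu g'E]] := poly_factor_root_seq g'0 s_uniq crit_s.
case: s => [|s0 s'] in s_uniq size_s crit_s mu_gt0 sum_mu g'E.
  by rewrite -size_s in hn.
have size_s' : size s' = (n - 1)%N by rewrite -size_s subn1.
(* The type of the default value confines [big_nth] to the lists of points; it
   would otherwise apply again to the lists of indices that it produces. *)
move: sum_mu g'E; rewrite !big_cons !(big_nth (0 : Kbar)) !big_mkord size_s'.
move=> sum_mu g'E.
pose k (l : 'I_(n - 1)) := mu s'`_l.
pose gamma (l : 'I_(n - 1)) := s'`_l - s0.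
have k_gt0 l : (0 < k l)%N.
  by apply: mu_gt0; rewrite inE mem_nth ?orbT // size_s'.
have mu0_gt0 : (0 < mu s0)%N by apply: mu_gt0; rewrite mem_head.
have leq_sum_k : (n - 1 <= \sum_l k l)%N.
  by rewrite -[leqLHS]card_ord -sum1_card; apply: leq_sum.
have d_eq : d = (mu s0 + \sum_l k l).+1.
  rewrite sum_mu size_g' prednK //.
  by rewrite -size_g' lt0n size_poly_eq0.
exists k; split=> //.
- by rewrite d_eq subSS -addnBAC // leq_addl.
(* The derivative of the normal form has leading coefficient [d! / m!], that of
   the conjugate [f] has the one of [g^`()]; [a] is their ratio. *)
pose a := lead_coef g^`() / (d`!%:R / (d - \sum_l k l - 1)`!%:R).
pose f := g \Po ('X + s0%:P) - s0%:P.
exists a, (f`_0 - (a *: normal_form d k gamma)`_0), gamma.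
have mu0E : (d - \sum_l k l - 1 = mu s0)%N.
  by rewrite d_eq subnAC subn1 /= addnK.
rewrite -(@deriv_eq_addC _ charL0 f).
  by apply: conjugate_to_translation; rewrite deg_g d_eq.
rewrite derivB derivC subr0 deriv_comp derivD derivX derivC addr0 mulr1 derivZ.
rewrite (deriv_normal_form charL0); last by rewrite d_eq ltnS leq_addl.
rewrite scalerA /a divfK; last first.
  by rewrite mulf_neq0 ?invr_eq0 ?natr_eq0 -?lt0n ?fact_gt0.
rewrite {1}g'E comp_polyZ rmorphM rmorph_prod rmorphXn /=.
rewrite comp_polyB comp_polyX comp_polyC addrK mu0E; congr (_ *: (_ * _)).
apply: eq_bigr => l _.
by rewrite rmorphXn /= comp_polyB comp_polyX comp_polyC polyCB opprB addrA.
Qed.
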